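(* For every odd integer $n\geq 1$, there exists a globally simple $\mathrm{N}\mathrm{H}_{2n}(n;n)$.
   Context: Let $n,t\ge 1$ be integers with $t$ dividing $2n^2$, let $v=2n^2+t$, and let $J$ be the subgroup of $\mathbb{Z}_v$ of order $t$. A (square, tight, relative) non-zero sum Heffter array $\mathrm{N}\mathrm{H}_t(n;n)$ is an $n\times n$ array $A$ with no empty cells and with entries in $\mathbb{Z}_v$ such that: (i) the multiset $\{\pm x \mid x\in A\}$ contains each element of $\mathbb{Z}_v\setminus J$ exactly once (and no other element); (ii) the sum of the elements in every row and in every column is different from $0$ in $\mathbb{Z}_v$. An ordering $(t_1,\dots,t_k)$ of a finite list of elements of an abelian group is simple if its partial sums $s_i=\sum_{j=1}^i t_j$, $i=1,\dots,k$, are all non-zero and pairwise distinct. A natural ordering of a row (respectively column) is the ordering of its entries read cyclically from left to right (respectively from top to bottom) starting from some chosen entry. The array is globally simple if each row and each column admits at least one natural ordering that is simple. *)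

(* Defs.v *)
From HB Require Import structures.
From mathcomp Require Import all_boot all_order all_algebra all_fingroup.

Set Implicit Arguments.
Unset Strict Implicit.
Unset Printing Implicit Defensive.

Import GRing.Theory.
Local Open Scope ring_scope.

(* 'Z_v is the integers modulo v only for v > 1; this holds for
   v = heffter_modulus n t as soon as 0 < n. *)
Definition heffter_modulus (n t : nat) : nat := (2 * n ^ 2 + t)%N.

Section Arrays.

Variables (V : zmodType) (n : nat).
Implicit Type A : 'M[V]_n.

Definition row_entries A (i : 'I_n) : seq V := [seq A i j | j <- enum 'I_n].
Definition col_entries A (j : 'I_n) : seq V := [seq A i j | i <- enum 'I_n].

(* The multiset {x, -x | x in A}: each cell contributes two occurrences, even
   when its entry satisfies x = -x. *)
Definition signed_entries A : seq V :=
  flatten [seq [:: A ij.1 ij.2; - A ij.1 ij.2] | ij <- enum {: 'I_n * 'I_n}].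

Definition partial_sums (s : seq V) : seq V := scanl +%R 0 s.

Definition simple_ordering (s : seq V) : Prop :=
  0 \notin partial_sums s /\ uniq (partial_sums s).

(* The natural orderings of a line are the rotations of its list of entries;
   rot k s starts at the entry of index k. *)
Definition has_simple_natural_ordering (s : seq V) : Prop :=
  exists2 k, (k < size s)%N & simple_ordering (rot k s).

Definition globally_simple A : Prop :=
  (forall i, has_simple_natural_ordering (row_entries A i)) /\
  (forall j, has_simple_natural_ordering (col_entries A j)).

End Arrays.

(* The cyclic group 'Z_v has a unique subgroup of each order dividing v, so J
   is determined by #|J| = t. *)
Definition nonzero_sum_heffter (n t : nat) (A : 'M['Z_(heffter_modulus n t)]_n) : Prop :=
  [/\ (0 < n)%N, (0 < t)%N & (t %| 2 * n ^ 2)%N] /\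
  exists J : {group 'Z_(heffter_modulus n t)},
    [/\ #|J| = t,
        perm_eq (signed_entries A) (enum (~: J)),
        forall i, \sum_(j < n) A i j != 0
      & forall j, \sum_(i < n) A i j != 0].

Arguments nonzero_sum_heffter : clear implicits.

(* Main.v *)
Require Import Defs.
From HB Require Import structures.
From mathcomp Require Import all_boot all_order all_algebra all_fingroup.
From mathcomp Require Import cyclic zify.

Set Implicit Arguments.
Unset Strict Implicit.
Unset Printing Implicit Defensive.

Import GRing.Theory.
Local Open Scope ring_scope.

(** Put m = n + 1, so that v = 2nm and J consists of the multiples of m, and
    take the entry in row i and column j (both counted from 0) to be
    (-1)^(i+j) (mi + j + 1). The absolute values are the integers in [1, nm]
    not divisible by m. Up to a global sign every line has the form
    a, -(a + d), a + 2d, ..., with d = 1 for rows and d = m for columns, and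
    its partial sums are a, -d, a + d, -2d, a + 2d, .... *)

(** * Partial sums of alternating arithmetic progressions *)

Lemma foldl_add_mkseq (V : zmodType) (F : nat -> V) n :
  foldl +%R 0 (mkseq F n) = \sum_(j < n) F j.
Proof.
elim: n => [|n IHn]; first by rewrite big_ord0.
by rewrite mkseqS foldl_rcons IHn big_ord_recr.
Qed.

(** [scanl] leaves out the initial [0], so index [k] holds a sum of [k.+1] terms. *)
Lemma partial_sums_mkseq (V : zmodType) (F : nat -> V) n :
  partial_sums (mkseq F n) = mkseq (fun k => \sum_(j < k.+1) F j) n.
Proof.
elim: n => // n IHn.
rewrite /partial_sums in IHn *.
by rewrite mkseqS scanl_rcons IHn -mkseqS foldl_add_mkseq -mkseqS.
Qed.

Section AlternatingProgression.

Variables (R : pzRingType) (e : nat) (a d : R).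

(** [e] is the index of the line within the array and carries its global sign. *)
Definition alternating_term (j : nat) : R := (-1) ^+ (e + j) * (a + d *+ j).

Definition alternating_sum (k : nat) : R :=
  if odd k then - (d *+ k./2.+1) else a + d *+ k./2.

Lemma sum_alternating_term k :
  \sum_(j < k.+1) alternating_term j = (-1) ^+ e * alternating_sum k.
Proof.
elim: k => [|k IHk]; first by rewrite big_ord1 /alternating_term addn0.
rewrite big_ord_recr IHk /alternating_term /= exprD -mulrA -mulrDr.
congr (_ * _); rewrite /alternating_sum exprS mulN1r -signr_odd /=.
(* Relative to [(-1) ^+ e], the new term enters with a plus sign for odd [k], and for even [k] with
   a minus sign that cancels [a]. *)
case: ifPn => [ok|ek].
  rewrite /= uphalf_half ok add1n expr1 opprK mul1r addrCA; congr (_ + _).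
  have -> : k.+1 = (k./2.+1 + k./2.+1)%N by lia.
  by rewrite mulrnDr addKr.
rewrite expr0 uphalf_half (negbTE ek) add0n mulN1r opprD addrACA subrr add0r.
have -> : k.+1 = (k./2 + k./2.+1)%N by lia.
by rewrite mulrnDr opprD addNKr.
Qed.

Variable n : nat.
Hypotheses (d_neq0 : forall p, (0 < p <= n./2)%N -> d *+ p != 0)
           (a_neq0 : forall p, (p < n)%N -> a + d *+ p != 0).

Lemma alternating_sum_neq0 k : odd n -> (k < n)%N -> alternating_sum k != 0.
Proof.
move=> on ltkn; rewrite /alternating_sum; case: ifPn => ok.
  by rewrite oppr_eq0 d_neq0 //; lia.
by rewrite a_neq0 //; lia.
Qed.

Lemma mulrn_d_inj p q : (p <= n./2)%N -> (q <= n./2)%N ->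
  d *+ p = d *+ q -> p = q.
Proof.
wlog lepq : p q / (p <= q)%N => [hwlog lep leq dpq|_ leq dpq].
  by case/orP: (leq_total p q) => h; [|symmetry]; apply: hwlog.
apply/eqP; apply/idPn => neqpq.
have /d_neq0/eqP[] : (0 < q - p <= n./2)%N by lia.
by rewrite mulrnBr // dpq subrr.
Qed.

(** Indices of equal parity compare multiples of [d] with coefficients at most [n./2]; for opposite
    parities an equality would make some [a + d *+ p] with [p < n] vanish. *)
Lemma alternating_sum_inj : odd n -> {in gtn n &, injective alternating_sum}.
Proof.
move=> on k l; rewrite !inE /alternating_sum => ltkn ltln.
have cross p q : (p + q < n)%N -> a + d *+ p <> - (d *+ q).
  move=> ltpq /eqP; rewrite -subr_eq0 opprK -addrA -mulrnDr.
  exact/negP/a_neq0.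
case: ifPn => ok; case: ifPn => ol.
- by move/oppr_inj/mulrn_d_inj => h; lia.
- by move/esym/cross; case; lia.
- by move/cross; case; lia.
- by move/addrI/mulrn_d_inj => h; lia.
Qed.

Lemma simple_alternating : odd n -> simple_ordering (mkseq alternating_term n).
Proof.
move=> on; rewrite /simple_ordering partial_sums_mkseq.
under eq_mkseq => k do rewrite sum_alternating_term.
split.
  apply/mapP => -[k]; rewrite mem_iota => /andP[_ ltkn] /eqP.
  (* Multiplication by a sign is an involution, so the global sign cancels. *)
  rewrite -(mulr0 ((-1) ^+ e)) (inj_eq (can_inj (signrMK e))) eq_sym.
  exact/negP/alternating_sum_neq0.
apply/mkseq_uniqP => k l ltkn ltln /(can_inj (signrMK e)).
exact: alternating_sum_inj.
Qed.

Lemma has_simple_natural_ordering_alternating :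
  odd n -> has_simple_natural_ordering (mkseq alternating_term n).
Proof.
move=> on; exists 0%N; first by rewrite size_mkseq; case: (n) on.
by rewrite rot0; apply: simple_alternating.
Qed.

Lemma sum_alternating_neq0 : odd n -> \sum_(j < n) alternating_term j != 0.
Proof.
(* The total is the last partial sum, of index [n.-1]; [n] is positive because it is odd. *)
move=> on; have -> : n = n.-1.+1 by lia.
rewrite sum_alternating_term -(mulr0 ((-1) ^+ e)).
by rewrite (inj_eq (can_inj (signrMK e))) alternating_sum_neq0 //; lia.
Qed.

End AlternatingProgression.

(** * Residues modulo v and the subgroup J *)

Lemma map_enum_ord (T : Type) (F : nat -> T) n :
  [seq F (val i) | i <- enum 'I_n] = mkseq F n.
Proof. by rewrite /mkseq -val_enum_ord -map_comp. Qed.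

Lemma Zp_nat_eq0 v a : (1 < v)%N -> ((a%:R : 'Z_v) == 0) = (v %| a)%N.
Proof. by move=> v_gt1; rewrite -val_eqE /= val_Zp_nat. Qed.

Lemma dvdn_mulSnD n k r : (n.+1 %| n.+1 * k + r)%N = (n.+1 %| r)%N.
Proof. by rewrite dvdn_addr // dvdn_mulr. Qed.

Section MultiplesSubgroup.

Variables (v m : nat).
Hypotheses (v_gt1 : (1 < v)%N) (m_dvd_v : (m %| v)%N).

(** The group law of ['Z_v] is addition, so this power of [Zp1] is the residue of [m]. *)
Definition multiples : {group 'Z_v} := <[(Zp1 : 'Z_v) ^+ m]>%G.

Lemma card_multiples : #|multiples| = (v %/ m)%N.
Proof. by rewrite -[LHS]/(#[_]%g) orderXdiv order_Zp1 Zp_cast. Qed.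

Lemma mem_multiples (x : 'Z_v) : (x \in multiples) = (m %| x)%N.
Proof.
have exprZp1 k : ((Zp1 : 'Z_v) ^+ k)%g = k%:R by rewrite Zp_expg mul1n Zp_nat.
apply/cycleP/dvdnP => [[k ->]|[k xE]].
  (* Reduction modulo [v] preserves divisibility by [m] because [m] divides [v]. *)
  apply/dvdnP; rewrite -expgM exprZp1 val_Zp_nat // /dvdn modn_dvdm //.
  exact: dvdn_mulr.
by exists k; rewrite -expgM exprZp1 mulnC -xE natr_Zp.
Qed.

End MultiplesSubgroup.

(** * The array, its lines and its entries *)

Section Array.

Variable n : nat.
Hypothesis on : odd n.

Let v := heffter_modulus n (2 * n).

Let vE : v = (n.+1 * (2 * n))%N.
Proof. by rewrite /v /heffter_modulus; nia. Qed.

Let v_gt1 : (1 < v)%N.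
Proof. by rewrite vE; nia. Qed.

Definition alternating_array : 'M['Z_(heffter_modulus n (2 * n))]_n :=
  \matrix_(i, j) ((-1) ^+ (i + j) * (n.+1 * i + j.+1)%:R).

Let m_dvd_v : (n.+1 %| v)%N.
Proof. by rewrite vE dvdn_mulr. Qed.

(** Since [n.+1] divides [v], a nonzero remainder modulo [n.+1] suffices. *)
Let nat_neq0 k r : (0 < r <= n)%N -> ((n.+1 * k + r)%:R : 'Z_v) != 0.
Proof.
move=> r_bound; rewrite Zp_nat_eq0 //; apply/negP => /(dvdn_trans m_dvd_v).
by rewrite dvdn_mulSnD => /dvdn_leq; lia.
Qed.

Let small_neq0 a : (0 < a < v)%N -> (a%:R : 'Z_v) != 0.
Proof.
by move=> ?; rewrite Zp_nat_eq0 //; apply/negP => /dvdn_leq; lia.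
Qed.

Lemma row_term (i j : nat) :
  (-1) ^+ (i + j) * (n.+1 * i + j.+1)%:R
  = alternating_term i ((n.+1 * i + 1)%:R : 'Z_v) 1 j.
Proof. by rewrite /alternating_term -natrD -addnA. Qed.

Lemma col_term (i j : nat) :
  (-1) ^+ (i + j) * (n.+1 * i + j.+1)%:R
  = alternating_term j (j.+1%:R : 'Z_v) n.+1%:R i.
Proof. by rewrite /alternating_term -mulrnA -natrD addnC [(_ * _ + _)%N]addnC. Qed.

Let row_step_neq0 p : (0 < p <= n./2)%N -> (1 : 'Z_v) *+ p != 0.
Proof. by move=> p_bound; rewrite small_neq0 // vE; nia. Qed.

Let row_start_neq0 i p :
  (p < n)%N -> ((n.+1 * i + 1)%:R : 'Z_v) + 1 *+ p != 0.
Proof. by move=> ltpn; rewrite -natrD -addnA nat_neq0. Qed.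

(** These elements lie in J, so the argument is by size: [n.+1 * p] stays below [v]. *)
Let col_step_neq0 p : (0 < p <= n./2)%N -> (n.+1%:R : 'Z_v) *+ p != 0.
Proof. by move=> p_bound; rewrite -mulrnA small_neq0 // vE; nia. Qed.

Let col_start_neq0 j p :
  (j < n)%N -> (p < n)%N -> (j.+1%:R : 'Z_v) + n.+1%:R *+ p != 0.
Proof. by move=> ltjn ltpn; rewrite -mulrnA -natrD addnC nat_neq0. Qed.

Lemma globally_simple_alternating_array : globally_simple alternating_array.
Proof.
split=> [i|j].
  rewrite /row_entries; under eq_map => j do rewrite mxE row_term.
  rewrite map_enum_ord.
  by apply: has_simple_natural_ordering_alternating => // p; apply: row_start_neq0.
rewrite /col_entries; under eq_map => i do rewrite mxE col_term.
rewrite (map_enum_ord (alternating_term j _ _)).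
by apply: has_simple_natural_ordering_alternating => // p; apply: col_start_neq0.
Qed.

Lemma sum_row_alternating_array i : \sum_(j < n) alternating_array i j != 0.
Proof.
under eq_bigr => j do rewrite mxE row_term.
by apply: sum_alternating_neq0 => // p; apply: row_start_neq0.
Qed.

Lemma sum_col_alternating_array j : \sum_(i < n) alternating_array i j != 0.
Proof.
under eq_bigr => i do rewrite mxE col_term.
by apply: sum_alternating_neq0 => // p; apply: col_start_neq0.
Qed.

(** Both signs of every entry are listed, so [b] is independent of the sign of the cell. *)
Lemma mem_signed_entries (i j : 'I_n) b :
  (-1) ^+ b * (n.+1 * i + j.+1)%:R \in signed_entries alternating_array.
Proof.
apply/flattenP; exists [:: alternating_array i j; - alternating_array i j].
  by apply/mapP; exists (i, j); rewrite ?mem_enum.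
rewrite mxE -signr_odd -[(-1) ^+ (i + j)]signr_odd !inE.
case: (odd b) (odd (i + j)) => -[] /=;
  by rewrite !(expr0, expr1, mul1r, mulN1r, opprK) eqxx ?orbT.
Qed.

Lemma size_signed_entries :
  size (signed_entries alternating_array) = (2 * n ^ 2)%N.
Proof.
rewrite size_flatten /shape -map_comp sumnE big_map big_enum /= sum_nat_const.
by rewrite card_prod !card_ord; lia.
Qed.

(* The entries exhaust the complement of J, and both sides have size 2n^2, so
   no repetition can occur. *)
Lemma perm_signed_entries :
  perm_eq (signed_entries alternating_array) (enum (~: multiples v n.+1)).
Proof.
have card_compl : #|~: multiples v n.+1| = (2 * n ^ 2)%N.
  have := cardsC (multiples v n.+1).
  rewrite card_multiples // card_ord Zp_cast // vE mulKn // => h; nia.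
have sub : {subset enum (~: multiples v n.+1)
            <= signed_entries alternating_array}.
  move=> x; rewrite mem_enum inE mem_multiples // => ndvd_x.
  have ltxv : (x < v)%N by rewrite -[v in (_ < v)%N]Zp_cast // ltn_ord.
  (* Division by [n.+1] locates the cell of absolute value [q]: the quotient is the row, the
     remainder minus one the column. *)
  have covered b q : ~~ (n.+1 %| q)%N -> (q < n.+1 * n)%N ->
      x = (-1) ^+ b * q%:R -> x \in signed_entries alternating_array.
    move=> ndvd_q ltq ->.
    have lti : (q %/ n.+1 < n)%N by rewrite ltn_divLR // mulnC.
    have ltr := ltn_pmod q (ltn0Sn n).
    have r_gt0 : (0 < q %% n.+1)%N by rewrite lt0n.
    have ltj : ((q %% n.+1).-1 < n)%N by lia.
    have -> : q = (n.+1 * Ordinal lti + (Ordinal ltj).+1)%N.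
      by rewrite /= prednK // mulnC -divn_eq.
    exact: mem_signed_entries.
  (* The threshold is half of [v]: smaller residues are taken as they are, the others as the
     opposite of [v - x]. *)
  have [ltx|lex] := ltnP x (n.+1 * n).
    apply: (covered 0%N x) => //; rewrite expr0 mul1r.
    by rewrite natr_Zp.
  apply: (covered 1%N (v - x)%N).
  - by rewrite dvdn_subr // ltnW.
  (* The midpoint is a multiple of [n.+1], hence excluded, so [v - x] is strictly below it. *)
  - have : (x != n.+1 * n :> nat)%N.
      by apply: contra ndvd_x => /eqP ->; rewrite dvdn_mulr.
    by move: vE; nia.
  rewrite expr1 mulN1r natrB ?(ltnW ltxv) // natr_Zp opprB.
  by have /eqP-> : (v%:R : 'Z_v) == 0; rewrite ?Zp_nat_eq0 // subr0.
have le_size : (size (signed_entries alternating_array)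
                <= size (enum (~: multiples v n.+1)))%N.
  by rewrite size_signed_entries -cardE card_compl.
have [_ eq_mem] := uniq_min_size (enum_uniq _) sub le_size.
apply: uniq_perm (enum_uniq _) _; last by move=> x; rewrite eq_mem.
exact: leq_size_uniq (enum_uniq _) sub le_size.
Qed.

Lemma nonzero_sum_heffter_alternating_array :
  nonzero_sum_heffter n (2 * n) alternating_array.
Proof.
split; first by split; [lia | lia | rewrite expnS expn1 mulnA dvdn_mulr].
exists (multiples v n.+1); split.
- by rewrite card_multiples // -/v vE mulKn.
- exact: perm_signed_entries.
- exact: sum_row_alternating_array.
- exact: sum_col_alternating_array.
Qed.

End Array.

Theorem proposition3p5 : forall n : nat, odd n ->
  exists A : 'M['Z_(heffter_modulus n (2 * n))]_n,
    nonzero_sum_heffter n (2 * n) A /\ globally_simple A.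
Proof.
move=> n on; exists (alternating_array n); split.
  exact: nonzero_sum_heffter_alternating_array.
exact: globally_simple_alternating_array.
Qed.
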